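(* Let $\mathcal{G}$ be a directed graph on $\{1,\dots,N\}$ with adjacency matrix $[a_{ij}]$ that contains a spanning tree. Consider the dynamics $$\dot\eta_i=S_i\eta_i+\mu_2\sum_{j\in\mathcal{N}_i}a_{ij}(\eta_j-\eta_i),\qquad \eta_i(t)\in\mathbb{R}^n,\quad i=1,\dots,N,$$ where the matrices $S_i(t)\in\mathbb{R}^{n\times n}$ are generated by $$\dot S_i=\mu_1\sum_{j\in\mathcal{N}_i}a_{ij}(S_j-S_i),\qquad i=1,\dots,N,$$ from initial values $S_i(0)\in\mathbb{R}^{n\times n}$. Then, for all sufficiently large $\mu_1$ and $\mu_2$ (depending on the graph and on $S_1(0),\dots,S_N(0)$) and arbitrary initial values $\eta_i(0)\in\mathbb{R}^n$, the signals $\eta_1(t),\dots,\eta_N(t)$ achieve consensus exponentially.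
   Context: The graph is static; $a_{ij}>0$ if $(j,i)$ is an edge and $a_{ij}=0$ otherwise, and $\mathcal{N}_i=\{j:(j,i)\text{ is an edge}\}$. ''Contains a spanning tree'' means a directed spanning tree: some node has a directed path to every other node. ''Achieve consensus exponentially'' means that $\eta_i(t)-\eta_j(t)\to0$ exponentially as $t\to\infty$ for all $i,j$ (the $\eta_i$ themselves need not be bounded). *)

(* Defs.v *)
From HB Require Import structures.
From mathcomp Require Import all_boot all_order all_algebra.
From mathcomp Require Import all_classical all_reals all_analysis.

Set Implicit Arguments.
Unset Strict Implicit.
Unset Printing Implicit Defensive.

Import Order.TTheory GRing.Theory Num.Theory.
Import numFieldNormedType.Exports.

Local Open Scope classical_set_scope.
Local Open Scope ring_scope.

(* A directed graph on 'I_N is a relation e, where e j i says that (j, i) is an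
   edge, from j to i. The weight a i j belongs to the edge (j, i): the first
   index is the head of the edge. *)

Definition adjacency_matrix (R : realType) (N : nat) (e : rel 'I_N)
    (a : 'M[R]_N) : Prop :=
  forall i j, (e j i -> 0 < a i j) /\ (~~ e j i -> a i j = 0).

Definition has_spanning_tree (N : nat) (e : rel 'I_N) : Prop :=
  exists r : 'I_N, forall i : 'I_N, connect e r i.

(* The sum over the neighbours j of i, that is over the edges (j, i), of
   a_ij (x_j - x_i). *)
Definition coupling (R : realType) (V : lmodType R) (N : nat) (e : rel 'I_N)
    (a : 'M[R]_N) (x : 'I_N -> V) (i : 'I_N) : V :=
  \sum_(j < N | e j i) a i j *: (x j - x i).

(* x' = f on the half-line t >= 0. At t = 0 only right-continuity is required,
   so that nothing is assumed about the values of x at negative times. *)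
Definition forward_solution (R : realType) (V : normedModType R)
    (x f : R -> V) : Prop :=
  x t @[t --> 0^'+] --> x 0 /\
  forall t : R, 0 < t -> is_derive t 1 x (f t).

Definition generator_dynamics (R : realType) (n N : nat) (e : rel 'I_N)
    (a : 'M[R]_N) (mu1 : R) (S : 'I_N -> R -> 'M[R]_n) : Prop :=
  forall i, forward_solution (S i)
    (fun t => mu1 *: coupling e a (fun j => S j t) i).

Definition signal_dynamics (R : realType) (n N : nat) (e : rel 'I_N)
    (a : 'M[R]_N) (mu2 : R) (S : 'I_N -> R -> 'M[R]_n)
    (eta : 'I_N -> R -> 'cV[R]_n) : Prop :=
  forall i, forward_solution (eta i)
    (fun t => S i t *m eta i t + mu2 *: coupling e a (fun j => eta j t) i).

Definition exponential_consensus (R : realType) (n N : nat)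
    (eta : 'I_N -> R -> 'cV[R]_n) : Prop :=
  forall i j, exists C alpha : R, 0 < alpha /\
    forall t : R, 0 <= t -> `|eta i t - eta j t| <= C * expR (- (alpha * t)).

(* Main.v *)
Require Import Defs.
From mathcomp Require Import all_boot all_order all_algebra.
From mathcomp Require Import all_classical all_reals all_analysis.
From mathcomp Require Import ring lra.
Import Order.TTheory GRing.Theory Num.Theory.
Import numFieldNormedType.Exports.
Local Open Scope ring_scope.

Set Implicit Arguments.
Unset Strict Implicit.

(* In the coupling term, the difference x_i - x_j, as a function of the pair
   (i, j), undergoes a diffusion over pairs in which either index moves backwards
   along an edge, and it vanishes on the diagonal. Since every index can be led
   back to the root of the spanning tree, every pair can reach the diagonal, so
   there are weights 1 <= w <= 2 with (A w)_(i,j) <= - lam w_(i,j) off the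
   diagonal, A being the generator of that diffusion. Comparison with barriers
   w_(i,j) G exp(- c t) then replaces any spectral analysis of the Laplacian.
   The maximum principle bounds the S_i uniformly in mu1, hence
   |eta_i| <= H exp(rho t) with rho independent of mu1 and mu2. For large mu1 the
   forcing (S_i - S_j) eta_j decays exponentially, and for large mu2 the coupling
   dominates the growth due to S_i in the equation of eta_i - eta_j. *)

(** * Finite bounds on families and matrix products *)

Lemma finite_strict_ub (R : realType) (I : finType) (F : I -> R) :
  exists2 K : R, 0 < K & forall p, F p < K.
Proof.
(* Starting the maximum at 0 keeps the bound positive even for empty [I]; adding 1 makes it
   strict. *)
exists (1 + \big[Num.max/0]_p F p).
  by rewrite ltr_pwDl// bigmax_ge_id.
by move=> p; rewrite ltr_pwDl// le_bigmax.
Qed.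

Lemma mulmx_entry_le (R : realType) m n p (M : 'M[R]_(m, n))
    (v : 'M[R]_(n, p)) (A B : R) i k :
    (forall j, `|M i j| <= A) -> (forall j, `|v j k| <= B) ->
  `|(M *m v) i k| <= n%:R * (A * B).
Proof.
move=> MA vB; rewrite mxE (le_trans (ler_norm_sum _ _ _))//.
rewrite mulr_natl -[n in leRHS](card_ord n) -sumr_const.
by apply: ler_sum => j _; rewrite normrM ler_pM.
Qed.

(** * Calculus of forward solutions and the first-contact principle *)

Section forward_solution.
Context {R : realType}.
Implicit Types (x y f g : R -> R^o).

Lemma forward_solutionB x y f g : forward_solution x f ->
  forward_solution y g ->
  forward_solution (fun t => x t - y t : R^o) (fun t => f t - g t).
Proof.
move=> [x0 xf] [y0 yg]; split; first exact: cvgB.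
by move=> t t0; have ? := xf _ t0; have ? := yg _ t0; exact: is_deriveB.
Qed.

Lemma forward_solutionZ c x f : forward_solution x f ->
  forward_solution (fun t => c * x t : R^o) (fun t => c * f t).
Proof.
move=> [x0 xf]; split; first exact: cvgZl_tmp.
by move=> t t0; have ? := xf _ t0; exact: is_deriveZ.
Qed.

Lemma forward_solution_cst (c : R) :
  @forward_solution R R^o (fun=> c) (fun=> 0).
Proof. by split; [exact: cvg_cst|move=> t _; exact: is_derive_cst]. Qed.

Lemma forward_solution_expR (c : R) :
  @forward_solution R R^o (fun t => expR (c * t)) (fun t => c * expR (c * t)).
Proof.
have D (t : R) :
  is_derive t 1 (fun t : R => expR (c * t) : R^o) (c * expR (c * t)).
  rewrite mulrC; apply: (is_derive1_comp (f := expR)).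
  have := is_deriveZ (f := id) c (is_derive_id t 1).
  by rewrite /GRing.scale/= mulr1.
split=> //; have [/derivable1_diffP/differentiable_continuous d0 _] := D 0.
exact: cvg_at_right_filter.
Qed.

Lemma forward_solution_entry m n (x f : R -> 'M[R]_(m, n)) i j :
  forward_solution x f ->
  @forward_solution R R^o (fun t => x t i j) (fun t => f t i j).
Proof.
move=> [x0 xf]; split.
  have := @coord_continuous R m n i j (x 0); exact: cvg_comp x0.
move=> t t0; have [dx <-] := xf _ t0.
by apply: DeriveDef; [exact: (derivable_mxP _ _ _).1|rewrite derive_mx// mxE].
Qed.

End forward_solution.

(* At the first time some f p vanishes, f p has been positive before, so its
   derivative there is nonpositive. *)
Lemma finite_barrier (R : realType) (I : finType) (f f' : I -> R -> R^o) :
    (forall p, forward_solution (f p) (f' p)) ->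
    (forall p, 0 < f p 0) ->
    (forall t p, 0 < t -> (forall q, 0 <= f q t) -> f p t = 0 ->
      0 < f' p t) ->
  forall t p, 0 <= t -> 0 < f p t.
Proof.
move=> sol f0 contact t1 p1 t1_ge0; rewrite ltNge; apply/negP => fp1.
have cont p t : 0 < t -> {for t, continuous (f p)}.
  move=> t0; have [d _] := (sol p).2 t t0.
  exact/differentiable_continuous/derivable1_diffP.
pose A := [set s : R | 0 <= s /\ exists p, f p s <= 0]%classic.
have Alb : has_lbound A by exists 0 => s [].
have hA : has_inf A by split=> //; exists t1; split=> //; exists p1.
pose T := inf A.
have before s p : 0 <= s -> s < T -> 0 < f p s.
  move=> s0 sT; rewrite ltNge; apply/negP => fps.
  by move: sT; rewrite ltNge ge_inf//; split=> //; exists p.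
(* Right-continuity at 0 keeps the finitely many members positive on a common initial interval. *)
have T0 : 0 < T.
  have : \forall s \near 0^'+%classic, forall p, 0 < f p s.
    by apply: filter_forall => p; exact: (cvgr_gt (f p 0) (sol p).1).
  case/nbhs_ballP => d /= d0 dball; apply: (lt_le_trans d0).
  apply: lb_le_inf => [|s [s0 [p fps]]]; first by case: hA.
  rewrite leNgt; apply/negP => sd; move: fps; apply/negP; rewrite -ltNge.
  have [->//|s_neq0] := eqVneq s 0.
  apply: dball; last by rewrite lt_neqAle eq_sym s_neq0.
  by rewrite /ball/= sub0r normrN ger0_norm.
have near_before : \forall s \near T^'-%classic, 0 < s /\ s < T.
  by apply: filterI; [exact: nbhs_left_gt|exact: nbhs_left_lt].
have atT q : 0 <= f q T.
  rewrite leNgt; apply/negP => fqT.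
  have /(cvgr_lt _)/(_ _ fqT) := cvg_at_left_filter (cont q T T0).
  move=> /(filterI near_before)/filter_ex[s [[s0 sT]]].
  by apply/negP; rewrite -leNgt ltW// before// ltW.
(* Otherwise positivity would persist beyond [T], against [T] being the infimum of [A]. *)
have [p fpT] : exists p, f p T <= 0.
  apply: contrapT => /forallNP fT.
  have : \forall s \near T, forall p, 0 < f p s.
    apply: (@filter_forall _ _ (fun p s => 0 < f p s) (nbhs T)) => p.
    have /(cvgr_gt _)/(_ 0) := cont p T T0; apply.
    by rewrite ltNge; apply/negP.
  case/nbhs_ballP => d /= d0 dball.
  have [s [s0 [p fps]] sTd] := inf_adherent d0 hA.
  have Ts : T <= s := ge_inf Alb (conj s0 (ex_intro _ p fps)).
  move: fps; apply/negP; rewrite -ltNge; apply: dball.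
  by rewrite /ball/= distrC ger0_norm ?subr_ge0// ltrBlDl.
have fp0 : f p T = 0 by apply/eqP; rewrite eq_le fpT atT.
(* With [g] the continuous slope function at [T], a positive [g T] would make [f p] negative just
   before [T]. *)
have /is_derive1_caratheodory [g [gE gc gT]] := (sol p).2 T T0.
have := contact T p T0 atT fp0; rewrite -gT.
move=> /(cvgr_gt _ (cvg_at_left_filter gc)).
move=> /(filterI near_before)/filter_ex[s [[s0 sT] gs]].
have := before s p (ltW s0) sT.
rewrite -[f p s]subr0 -[X in _ - X]fp0 gE pmulr_rgt0//.
by rewrite subr_gt0 ltNge (ltW sT).
Qed.

(** * Order properties of the coupling term *)

Section coupling.
Context {R : realType} {N : nat} {e : rel 'I_N} {a : 'M[R]_N}.

Lemma coupling_entry m n (M : 'I_N -> 'M[R]_(m, n)) i k l :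
  (coupling e a M i) k l = coupling e a (fun j => M j k l : R^o) i.
Proof. by rewrite summxE; apply: eq_bigr => j _; rewrite !mxE. Qed.

Lemma couplingZ c (x : 'I_N -> R^o) i :
  coupling e a (fun j => c * x j : R^o) i = c * coupling e a x i.
Proof.
by rewrite mulr_sumr; apply: eq_bigr => j _; rewrite /GRing.scale/=; ring.
Qed.

Hypothesis ha : adjacency_matrix e a.

Lemma coupling_le (x y : 'I_N -> R^o) i :
  (forall j, x j - x i <= y j - y i) -> coupling e a x i <= coupling e a y i.
Proof.
move=> xy; apply: ler_sum => j eji; rewrite ler_wpM2l ?xy// ltW//.
exact: (ha i j).1.
Qed.

Lemma coupling_at_max (x : 'I_N -> R^o) i :
  (forall j, x j <= x i) -> coupling e a x i <= 0.
Proof.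
move=> xi; have <- : coupling e a (fun=> 0 : R^o) i = 0.
  by rewrite /coupling big1// => j _; rewrite subrr scaler0.
by apply: coupling_le => j; rewrite subrr subr_le0.
Qed.

(* The differences x i - x j evolve by the coupling in each of the two indices,
   so a supersolution w for pairs controls them at a point of contact. *)
Lemma coupling_pair_contact (lam g : R) (w : 'I_N -> 'I_N -> R^o)
    (x : 'I_N -> R^o) i j : 0 <= g ->
    coupling e a (w ^~ j) i + coupling e a (w i) j <= - (lam * w i j) ->
    (forall k l, x k - x l <= w k l * g) -> x i - x j = w i j * g ->
  coupling e a x i - coupling e a x j <= - (lam * w i j) * g.
Proof.
move=> g0 wij xw xijE; apply: (@le_trans _ _
    (g * (coupling e a (w ^~ j) i + coupling e a (w i) j))); last first.
  by rewrite mulrC ler_wpM2r.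
rewrite mulrDr -!couplingZ lerD//; last first.
  rewrite -mulN1r -couplingZ; apply: coupling_le => k.
  by have := xw i k; lra.
by apply: coupling_le => k; have := xw k j; lra.
Qed.

End coupling.

(** * Supersolution of the pair walk *)

(** Take for [d] the length of a shortest path from [r]: the last node before [i] on such a path is
    strictly closer to [r]. *)
Lemma connect_depth (T : finType) (e : rel T) (r : T) :
    (forall i, connect e r i) ->
  exists d : T -> nat, forall i, i != r -> exists2 j, e j i & (d j < d i)%N.
Proof.
move=> er.
pose P i n := [exists p : n.-tuple T, path e r p && (last r p == i)].
have PE i p : path e r p -> last r p = i -> P i (size p).
  by move=> ep lp; apply/existsP; exists (in_tuple p); rewrite ep lp eqxx.
have exP i : exists n, P i n.
  by have /connectP[p ep lp] := er i; exists (size p); exact: PE.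
exists (fun i => ex_minn (exP i)) => i ir.
case: (ex_minnP (exP i)) => n /existsP[p /andP[ep /eqP lp]] _.
move: ep lp; rewrite -{3}(size_tuple p).
case: (lastP p) => [/= _ ri|q z]; first by rewrite ri eqxx in ir.
rewrite rcons_path last_rcons => /andP[eq ez] <-.
exists (last r q) => //; rewrite size_rcons ltnS.
by case: ex_minnP => m _; apply; exact: PE.
Qed.

(* Two walkers that move backwards along edges can always meet at the root;
   the weight 2 - eps ^ depth is a strict supersolution for this pair walk
   because stepping towards the root outweighs every other step. *)
Lemma pair_supersolution (R : realType) (N : nat) (e : rel 'I_N)
    (a : 'M[R]_N) : adjacency_matrix e a -> has_spanning_tree e ->
  exists (lam : R) (w : 'I_N -> 'I_N -> R^o), [/\ 0 < lam,
    forall i j, 1 <= w i j, forall i j, w i j <= 2 &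
    forall i j, i != j ->
      coupling e a (w ^~ j) i + coupling e a (w i) j <= - (lam * w i j)].
Proof.
move=> ha [r /connect_depth[d dP]].
(* Bounding the inverse weights bounds all edge weights below by [A^-1]; off the edges the inverse
   of 0 is 0, which is harmless. *)
have [A A0 aA] := finite_strict_ub (fun p : 'I_N * 'I_N => (a p.1 p.2)^-1).
have [B B0 aB] :=
  finite_strict_ub (fun i : 'I_N => \sum_(j < N | e j i) a i j).
have a_gt i j : e j i -> A^-1 < a i j.
  move=> eji; have a0 := (ha i j).1 eji.
  by rewrite -[ltRHS]invrK ltf_pV2 ?posrE ?invr_gt0//; exact: aA (i, j).
set a0 := A^-1 in a_gt; have a0_gt0 : 0 < a0 by rewrite invr_gt0.
(* With E = eps ^ (d i + d j), this ratio makes a step towards the root contribute at most -(2B+1)E.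
   The other neighbours of that index cost at most BE and those of the other index BE, so -E
   remains. *)
pose eps := a0 / (a0 + 2 * B + 1).
have den_gt0 : 0 < a0 + 2 * B + 1 by lra.
have eps0 : 0 < eps by rewrite divr_gt0.
have eps1 : eps < 1 by rewrite ltr_pdivrMr//; lra.
pose w i j : R^o := 2 - eps ^+ (d i + d j).
have expe_gt0 m : 0 < eps ^+ m by rewrite exprn_gt0.
have expe_le1 m : eps ^+ m <= 1 by rewrite exprn_ile1// ltW.
have wC i j : w i j = w j i by rewrite /w addnC.
have any i j : coupling e a (w ^~ j) i <= B * eps ^+ (d i + d j).
  apply: (@le_trans _ _ (\sum_(k < N | e k i) a i k * eps ^+ (d i + d j))).
    apply: ler_sum => k eki; rewrite ler_wpM2l//.
      by rewrite ltW// (lt_trans a0_gt0)// a_gt.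
    by rewrite /w; have := expe_gt0 (d k + d j); lra.
  by rewrite -mulr_suml ler_wpM2r// ltW.
have root i : i != r -> forall j,
    coupling e a (w ^~ j) i <= - (B + 1) * eps ^+ (d i + d j).
  move=> ir j; have [k eki dki] := dP i ir.
  have step : eps ^+ (d i + d j) <= eps * eps ^+ (d k + d j).
    by rewrite -exprS ler_wiXn2l ?ltW// -addSn leq_add2r.
  set E := eps ^+ (d i + d j) in step *; set F := eps ^+ (d k + d j) in step.
  have E0 : 0 < E := expe_gt0 _.
  have aFE : a i k * (w k j - w i j) <= - (2 * B + 1) * E.
    have wE : w k j - w i j = E - F by rewrite /w -/E -/F; lra.
    have EF : E - F <= 0 by have := expe_gt0 (d k + d j)%N; rewrite -/F; nra.
    apply: (@le_trans _ _ (a0 * (E - F))).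
      by rewrite wE ler_wnM2r// ltW// a_gt.
    have : (a0 + 2 * B + 1) * E <= a0 * F.
      rewrite mulrC -ler_pdivlMr// (le_trans step)// /eps le_eqVlt; apply/orP.
      by left; apply/eqP; field; rewrite gt_eqF.
    lra.
  rewrite /coupling (bigD1 k)//=.
  have : \sum_(l < N | e l i && (l != k)) a i l *: (w l j - w i j) <= B * E.
    apply: (@le_trans _ _ (\sum_(l < N | e l i) a i l * E)); last first.
      by rewrite -mulr_suml ler_wpM2r// ltW.
    rewrite [leRHS](bigD1 k)//= -[leLHS]add0r lerD//.
      by rewrite mulr_ge0// ltW// (lt_trans a0_gt0)// a_gt.
    apply: ler_sum => l /andP[eli _]; rewrite ler_wpM2l//.
      by rewrite ltW// (lt_trans a0_gt0)// a_gt.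
    by rewrite /w -/E; have := expe_gt0 (d l + d j)%N; lra.
  rewrite /GRing.scale/=; lra.
have [D dD] : exists D : nat, forall i j, (d i + d j <= D)%N.
  exists (\max_i d i + \max_i d i)%N => i j.
  by rewrite leq_add// leq_bigmax.
(* As [w <= 2], lam w is at most [eps ^+ D], hence at most the gain [eps ^+ (d i + d j)]. *)
exists (eps ^+ D / 2), w; split.
- by rewrite divr_gt0.
- by move=> i j; rewrite /w; have := expe_le1 (d i + d j)%N; lra.
- by move=> i j; rewrite /w; have := expe_gt0 (d i + d j)%N; lra.
move=> i j ij; apply: (@le_trans _ _ (- eps ^+ (d i + d j))).
  have -> : coupling e a (w i) j = coupling e a (w ^~ i) j.
    by congr coupling; apply/funext => k; exact: wC.
  have := any j i; have := any i j; rewrite (addnC (d j)).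
  (* Off the diagonal at least one index differs from the root and can step towards it. *)
  have [ir|/root] := eqVneq i r; last by move=> /(_ j); lra.
  have /root/(_ i) : j != r by rewrite -ir eq_sym.
  by rewrite (addnC (d j)); lra.
have : eps ^+ D <= eps ^+ (d i + d j) by rewrite ler_wiXn2l// ltW.
have := expe_gt0 D; have := expe_gt0 (d i + d j)%N; rewrite /w; nra.
Qed.

(** * Comparison bounds for forced coupled systems *)

Lemma ler_norm_sign (R : realType) (x c : R) :
  (forall b : bool, (-1) ^+ b * x <= c) -> `|x| <= c.
Proof.
move=> xc; have := xc true; have := xc false.
by rewrite /= expr0 expr1 ler_norml; lra.
Qed.

Section coupled_system.
Context {R : realType} {N : nat} {e : rel 'I_N} {a : 'M[R]_N} {I : finType}.
Context {mu : R} {x h : 'I_N -> I -> R -> R^o}.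
Hypothesis ha : adjacency_matrix e a.
Hypothesis mu0 : 0 <= mu.
Hypothesis solx : forall i k, forward_solution (x i k)
  (fun t => h i k t + mu * coupling e a (fun j => x j k t) i).

(** At first contact with the barrier the touching signed component is maximal over the nodes, so
    the coupling only pulls it inward and [b'] has to beat [h] alone. The bound is therefore uniform
    in [mu]. *)
Lemma coupled_bound (b b' : R -> R^o) : forward_solution b b' ->
    (forall i k, `|x i k 0| < b 0) ->
    (forall t, 0 < t -> (forall i k, `|x i k t| <= b t) ->
      forall i k, `|h i k t| < b' t) ->
  forall i k t, 0 <= t -> `|x i k t| <= b t.
Proof.
move=> solb x0 hb i k t t0; apply: ler_norm_sign => s; apply: ltW.
rewrite -subr_gt0.
apply: (finite_barrier (I := (bool * 'I_N * I)%type)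
  (f := fun p t => b t - (-1) ^+ p.1.1 * x p.1.2 p.2 t)
  (f' := fun p t => b' t - (-1) ^+ p.1.1 * (h p.1.2 p.2 t +
    mu * coupling e a (fun j => x j p.2 t) p.1.2)) _ _ _ (s, i, k) t0).
- by move=> p; apply: forward_solutionB => //; apply: forward_solutionZ.
- move=> p; rewrite subr_gt0 (le_lt_trans (ler_norm _))//.
  by rewrite normrM normr_sign mul1r.
move=> {}t [[{}s {}i] {}k] /= {}t0 fge0 /eqP; rewrite subr_eq0 => /eqP bE.
have xb j l : `|x j l t| <= b t.
  by apply: ler_norm_sign => s'; have := fge0 (s', j, l); rewrite subr_ge0.
have hs : (-1) ^+ s * h i k t < b' t.
  apply: le_lt_trans (hb t t0 xb i k).
  by rewrite (le_trans (ler_norm _))// normrM normr_sign mul1r.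
have : coupling e a (fun j => (-1) ^+ s * x j k t : R^o) i <= 0.
  apply: coupling_at_max => // j; rewrite -bE.
  by have := fge0 (s, j, k); rewrite subr_ge0.
rewrite couplingZ mulrDr mulrCA => /(mulr_ge0_le0 mu0); lra.
Qed.

Context {lam : R} {w : 'I_N -> 'I_N -> R^o}.
Hypotheses (w_ge1 : forall i j, 1 <= w i j) (w_le2 : forall i j, w i j <= 2).
Hypothesis w_super : forall i j, i != j ->
  coupling e a (w ^~ j) i + coupling e a (w i) j <= - (lam * w i j).

(** The barrier for x_i - x_j is [w i j * g t]. It is positive, so contact occurs off the diagonal,
    where the coupling supplies the damping mu lam w g. Ordered pairs cover both signs, and [w <= 2]
    gives the factor 2. *)
Lemma coupled_disagreement (g g' : R -> R^o) : forward_solution g g' ->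
    (forall i j k, x i k 0 - x j k 0 < g 0) ->
    (forall t, 0 <= t -> 0 < g t) ->
    (forall t, 0 < t -> (forall i j k, `|x i k t - x j k t| <= 2 * g t) ->
      forall i j k, h i k t - h j k t < w i j * (g' t + mu * lam * g t)) ->
  forall i j k t, 0 <= t -> `|x i k t - x j k t| <= 2 * g t.
Proof.
move=> solg x0 g0 hg.
have two t : 0 <= t ->
    (forall i j k, x i k t - x j k t <= w i j * g t) ->
    forall i j k, `|x i k t - x j k t| <= 2 * g t.
  move=> t0 xw i j k; have wg i' j' : w i' j' * g t <= 2 * g t.
    by rewrite ler_wpM2r// ltW// g0.
  have := xw i j k; have := xw j i k; have := wg i j; have := wg j i.
  by rewrite ler_norml; lra.
move=> i j k t t0; apply: (two) => // {}i {}j {}k; apply: ltW.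
rewrite -subr_gt0.
apply: (finite_barrier (I := ('I_N * 'I_N * I)%type)
  (f := fun p t => w p.1.1 p.1.2 * g t - (x p.1.1 p.2 t - x p.1.2 p.2 t))
  (f' := fun p t => w p.1.1 p.1.2 * g' t -
    (h p.1.1 p.2 t + mu * coupling e a (fun j => x j p.2 t) p.1.1 -
     (h p.1.2 p.2 t + mu * coupling e a (fun j => x j p.2 t) p.1.2)))
  _ _ _ (i, j, k) t0).
- move=> p; apply: forward_solutionB; first exact: forward_solutionZ.
  exact: forward_solutionB.
- move=> [[{}i {}j] {}k]/=; rewrite subr_gt0 (lt_le_trans (x0 _ _ _))//.
  by rewrite ler_peMl// ltW// g0.
move=> {}t [[{}i {}j] {}k] /= {}t0 fge0 /eqP; rewrite subr_eq0 => /eqP xE.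
have gt0 := g0 t (ltW t0).
have xw i' j' k' : x i' k' t - x j' k' t <= w i' j' * g t.
  by have := fge0 (i', j', k'); rewrite subr_ge0.
have ij : i != j.
  apply: contraTneq gt0 => ij; move: xE; rewrite ij subrr => /eqP.
  rewrite mulf_eq0 => /orP[|] /eqP E; have := w_ge1 j j; rewrite E ?ltxx//.
  by lra.
have := hg t t0 (two t (ltW t0) xw) i j k.
have := coupling_pair_contact ha (ltW gt0) (w_super ij)
  (fun i j => xw i j k) (esym xE).
by move=> /(ler_wpM2l mu0); lra.
Qed.

End coupled_system.

(** * Choice of gains and barriers for the generators and signals *)

Theorem lemma4 (R : realType) (N n : nat) (e : rel 'I_N) (a : 'M[R]_N)
    (ha : adjacency_matrix e a) (htree : has_spanning_tree e)
    (S0 : 'I_N -> 'M[R]_n) :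
  exists mu1_min mu2_min : R,
    forall mu1 mu2 : R, mu1_min <= mu1 -> mu2_min <= mu2 ->
    forall S : 'I_N -> R -> 'M[R]_n,
      (forall i, S i 0 = S0 i) ->
      generator_dynamics e a mu1 S ->
    forall (eta0 : 'I_N -> 'cV[R]_n) (eta : 'I_N -> R -> 'cV[R]_n),
      (forall i, eta i 0 = eta0 i) ->
      signal_dynamics e a mu2 S eta ->
      exponential_consensus eta.
Proof.
have [lam [w [lam0 w_ge1 w_le2 w_super]]] := pair_supersolution ha htree.
have [K K0 S0K] := finite_strict_ub
  (fun p : 'I_N * ('I_n * 'I_n) => `|S0 p.1 p.2.1 p.2.2|).
(* [L] bounds the row sums of every |S_i(t)| once its entries are at most 2K; [rho] exceeds [L] so
   that the growth barrier for eta is strict. *)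
pose L := n%:R * (2 * K); have L0 : 0 <= L by rewrite !mulr_ge0// ltW.
pose rho := L + 1; have rho1 : 1 <= rho by rewrite lerDr.
(* The damping mu lam is then at least 2 rho + 1: more than the decay rate rho + 1 wanted for S_i -
   S_j, and 2 rho above the rate 1 wanted for eta_i - eta_j. *)
exists ((2 * rho + 1) / lam), ((2 * rho + 1) / lam) => mu1 mu2.
rewrite !ler_pdivrMr// => mu1_ge mu2_ge S SS0 Sdyn eta0 eta etaE etadyn.
have mu1_0 : 0 <= mu1 by rewrite -(pmulr_lge0 _ lam0); lra.
have mu2_0 : 0 <= mu2 by rewrite -(pmulr_lge0 _ lam0); lra.
have [H H0 etaH] := finite_strict_ub
  (fun p : 'I_N * 'I_n => `|eta0 p.1 p.2 0|).
pose xS i (p : 'I_n * 'I_n) t : R^o := S i t p.1 p.2.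
have solS i p : forward_solution (xS i p)
    (fun t => 0 + mu1 * coupling e a (fun j => xS j p t) i).
  have := forward_solution_entry p.1 p.2 (Sdyn i).
  congr forward_solution; apply/funext => t.
  by rewrite mxE coupling_entry add0r.
pose xe i (k : 'I_n) t : R^o := eta i t k 0.
have sole i k : forward_solution (xe i k)
    (fun t => (S i t *m eta i t) k 0 +
              mu2 * coupling e a (fun j => xe j k t) i).
  have := forward_solution_entry k 0 (etadyn i).
  congr forward_solution; apply/funext => t.
  by rewrite mxE [X in _ + X]mxE coupling_entry.
have S_bound i t k l : 0 <= t -> `|S i t k l| <= 2 * K.
  (* A constant barrier has no strict derivative; this one increases from K towards 2K. *)
  move=> t0; have solb : forward_solution
      (fun t => 2 * K - K * expR (-1 * t) : R^o)
      (fun t => 0 - K * (-1 * expR (-1 * t))).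
    apply: forward_solutionB; first exact: forward_solution_cst.
    by apply: forward_solutionZ; exact: forward_solution_expR.
  apply: (le_trans (coupled_bound ha mu1_0 solS solb _ _ i (k, l) t0)).
  - move=> {}i p; rewrite /xS SS0 mulr0 expR0; have := S0K (i, p) => /=; lra.
  - by move=> {}t {}t0 _ _ _; rewrite normr0 mulN1r mulrN opprK add0r
      mulr_gt0// expR_gt0.
  by rewrite gerBl mulr_ge0// ?expR_ge0// ltW.
have S_dis i j t k l : 0 <= t ->
    `|S i t k l - S j t k l| <= 2 * (2 * K * expR (- (rho + 1) * t)).
  (* The rate rho + 1 outpaces the growth exp(rho t) of eta and leaves exp(-t) for the product. *)
  move=> t0; have solg := forward_solutionZ (2 * K)
    (forward_solution_expR (- (rho + 1))).
  have g0 s : 0 < 2 * K * expR (- (rho + 1) * s).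
    by rewrite !mulr_gt0// expR_gt0.
  apply: (coupled_disagreement ha mu1_0 solS w_ge1 w_le2 w_super solg
    _ _ _ i j (k, l) t0).
  - move=> {}i {}j p; rewrite /xS !SS0 mulr0 expR0 mulr1.
    have := S0K (i, p); have := S0K (j, p) => /=.
    by rewrite !ltr_norml => /andP[? ?] /andP[? ?]; lra.
  - by move=> s _; exact: g0.
  - move=> s _ _ {}i {}j _; rewrite subr0.
    rewrite mulr_gt0 ?(lt_le_trans _ (w_ge1 i j))//.
    by have := g0 s; nra.
have eta_bound i t k : 0 <= t -> `|eta i t k 0| <= H * expR (rho * t).
  move=> t0; have solb := forward_solutionZ H (forward_solution_expR rho).
  have b0 s : 0 < H * expR (rho * s) by rewrite mulr_gt0// expR_gt0.
  apply: (coupled_bound ha mu2_0 sole solb _ _ i k t0).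
  - by move=> {}i {}k; rewrite /xe etaE mulr0 expR0 mulr1 (etaH (i, k)).
  - move=> s s0 xb {}i {}k; apply: (@le_lt_trans _ _
        (n%:R * (2 * K * (H * expR (rho * s))))).
      by apply: mulmx_entry_le => l; [exact/S_bound/ltW|exact: xb].
    by have := b0 s; rewrite /rho /L; nra.
(* 2H covers the initial disagreement and LH the forcing (S_i - S_j) eta_j, of size 2LH exp(-t); the
   spare margin is 4H exp(-t). *)
pose G := L * H + 2 * H; have G0 : 0 < G by rewrite /G; nra.
have eta_dis i j t k : 0 <= t ->
    `|eta i t k 0 - eta j t k 0| <= 2 * (G * expR (-1 * t)).
  move=> t0; have solg := forward_solutionZ G (forward_solution_expR (-1)).
  have g0 s : 0 < G * expR (-1 * s) by rewrite mulr_gt0// expR_gt0.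
  apply: (coupled_disagreement ha mu2_0 sole w_ge1 w_le2 w_super solg
    _ _ _ i j k t0).
  - move=> {}i {}j {}k; rewrite /xe !etaE mulr0 expR0 mulr1 /G.
    have := etaH (i, k); have := etaH (j, k) => /=.
    by rewrite !ltr_norml => /andP[? ?] /andP[? ?]; nra.
  - by move=> s _; exact: g0.
  move=> s s0 xd {}i {}j {}k.
  have -> : (S i s *m eta i s) k 0 - (S j s *m eta j s) k 0 =
      (S i s *m (eta i s - eta j s)) k 0 + ((S i s - S j s) *m eta j s) k 0.
    by rewrite mulmxBr mulmxBl !mxE; lra.
  have h1 : `|(S i s *m (eta i s - eta j s)) k 0| <=
      n%:R * (2 * K * (2 * (G * expR (-1 * s)))).
    apply: mulmx_entry_le => l; first exact/S_bound/ltW.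
    by have := xd i j l; rewrite !mxE.
  have h2 : `|((S i s - S j s) *m eta j s) k 0| <=
      n%:R * (2 * (2 * K * expR (- (rho + 1) * s)) * (H * expR (rho * s))).
    apply: mulmx_entry_le => l; last exact/eta_bound/ltW.
    by rewrite !mxE; exact/S_dis/ltW.
  have eE : expR (-1 * s) = expR (- (rho + 1) * s) * expR (rho * s).
    by rewrite -expRD; congr expR; ring.
  move: h1 h2; rewrite !ler_norml => /andP[_ h1] /andP[_ h2].
  apply: (le_lt_trans (lerD h1 h2)).
  (* Here [w >= 1] and mu2 lam - 1 >= 2 rho enter. *)
  apply: (@lt_le_trans _ _ (1 * (2 * rho * (G * expR (-1 * s))))); last first.
    rewrite ler_pM//; first by have := g0 s; nra.
    by have := g0 s; nra.
  rewrite /rho /G /L eE -subr_gt0 [ltRHS](_ : _ =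
    4 * H * (expR (- (rho + 1) * s) * expR (rho * s))); last by ring.
  by rewrite !mulr_gt0// expR_gt0.
move=> i j; exists (2 * G), 1; split=> // t t0.
rewrite [leLHS]/Num.Def.normr/= mx_normrE bigmax_le//.
  by rewrite !mulr_ge0 ?expR_ge0// ltW.
move=> [k l] _; rewrite !mxE (ord1 l) mul1r -[X in expR X]mulN1r -mulrA.
exact: eta_dis.
Qed.
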